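(* Let $A$ be a finite alphabet, $F_A$ the free group on $A$, and $H\leqslant F_A$ a finitely generated subgroup. Then the three closures of $H$ with respect to the ambient free group $F_A$ coincide: $\mathcal{C}l_{F_A}(H)=f\mathcal{OC}l_{F_A}(H)=\mathcal{OC}l_{F_A}(H)$, and this subgroup is a free factor of $F_A$.
   Context: Stallings automata. Let $F$ be a free group with basis $C$. An involutive $C$-automaton is a directed graph (loops and parallel edges allowed) with edges labelled by elements of $C\cup C^{-1}$, with a distinguished vertex $\circledcirc$ (the basepoint), in which every edge $e$ from $p$ to $q$ labelled $c$ has an inverse edge $e^{-1}$ from $q$ to $p$ labelled $c^{-1}$. It is deterministic if no two different edges with the same label start (or end) at the same vertex. A path is reduced if it never crosses an edge immediately followed by its inverse. The automaton is trim if every vertex and edge appears in some reduced closed path at $\circledcirc$. A Stallings $C$-automaton is a connected, deterministic, trim involutive $C$-automaton. For each subgroup $H\leqslant F$ there is a unique (up to isomorphism) Stallings $C$-automaton $\Gamma_C(H)$ such that the set of labels of reduced closed paths at $\circledcirc$, read in $F$, is exactly $H$. A $C$-homomorphism between $C$-automata is a map sending vertices to vertices and edges to edges, preserving incidence, labels and basepoint. It is onto if it is surjective both on vertices and on edges. For $H\leqslant K\leqslant F$ there is a unique $C$-homomorphism $\theta_{H,K}\colon \Gamma_C(H)\to\Gamma_C(K)$. Let $H\leqslant K\leqslant F_A$. A free factor of $K$ is a subgroup having a basis that extends to a basis of $K$. - $H\leqslant K$ is algebraic if $H$ is not contained in any proper free factor of $K$. - $H\leqslant K$ is onto if $\theta_{H,K}\colon\Gamma_{A'}(H)\to\Gamma_{A'}(K)$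 is onto for every basis $A'$ of $F_A$. - $H\leqslant K$ is fully onto if, for every (possibly infinite) alphabet $B\supseteq A$ and every basis $B'$ of $F_B\geqslant F_A$, $\theta_{H,K}\colon\Gamma_{B'}(H)\to\Gamma_{B'}(K)$ is onto. Closures, for $H\leqslant K\leqslant F_A$ with $H$ finitely generated: - $\mathcal{C}l_K(H)$ is the unique subgroup $L$ with $H\leqslant L\leqslant K$ such that $H\leqslant L$ is algebraic and $L$ is a free factor of $K$; it is known to exist and to be both the smallest free factor of $K$ containing $H$ and the largest algebraic extension of $H$ contained in $K$. - $\mathcal{OC}l_K(H)$ is the subgroup generated by all the onto extensions of $H$ contained in $K$; it is the largest onto extension of $H$ contained in $K$. - $f\mathcal{OC}l_K(H)$ is the subgroup generated by all the fully onto extensions of $H$ contained in $K$; it is the largest fully onto extension of $H$ contained in $K$. *)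

(* Defs.v *)
From mathcomp Require Import all_boot.
From mathcomp Require Import boolp classical_sets functions cardinality.

Set Implicit Arguments.
Unset Strict Implicit.
Unset Printing Implicit Defensive.

Local Open Scope group_scope.
Local Open Scope classical_set_scope.

(* The signed letter (c, true) stands for c, and (c, false) for c^-1. *)
Definition letter (C : Type) := (C * bool)%type.

Definition flip (C : Type) (x : letter C) : letter C := (x.1, ~~ x.2).

Definition reduced_word (C : eqType) (w : seq (letter C)) : bool :=
  sorted (fun x y => y != flip x) w.

Section Subgroups.
Variable G : groupType.
Implicit Types H K L X : set G.

Definition is_subgroup H : Prop :=
  H 1 /\ (forall x y, H x -> H y -> H (x * y)) /\ (forall x, H x -> H x^-1).

Definition generated X : set G := smallest is_subgroup X.

Definition finitely_generated H : Prop :=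
  exists X, finite_set X /\ H = generated X.

Definition wval X (w : seq (letter X)) : G :=
  \prod_(x <- w) (if x.2 then val x.1 else (val x.1)^-1).

(* K is free with basis X; in particular G is a free group with basis X when
   [basis setT X]. *)
Definition basis K X : Prop :=
  generated X = K /\
  (forall w : seq (letter X), reduced_word w -> wval w = 1 -> w = [::]).

Definition free_factor K L : Prop :=
  exists X Y, [/\ X `<=` Y, basis L X & basis K Y].

Definition extension H K : Prop :=
  [/\ is_subgroup H, is_subgroup K & H `<=` K].

Definition algebraic H K : Prop :=
  extension H K /\ (forall L, free_factor K L -> H `<=` L -> L = K).

End Subgroups.

Record automaton (C : Type) := Automaton {
  vertex : Type;
  edge : Type;
  src : edge -> vertex;
  tgt : edge -> vertex;
  label : edge -> letter C;
  inv : edge -> edge;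
  base : vertex;
  invK : forall e, inv (inv e) = e;
  src_inv : forall e, src (inv e) = tgt e;
  tgt_inv : forall e, tgt (inv e) = src e;
  label_inv : forall e, label (inv e) = flip (label e)
}.

Arguments base {C} a.

Section Automata.
Variable C : Type.
Implicit Type Q : automaton C.

Fixpoint is_path Q (p : vertex Q) (s : seq (edge Q)) (q : vertex Q) : Prop :=
  if s is e :: s' then src e = p /\ is_path (tgt e) s' q else p = q.

Definition reduced_path Q (s : seq (edge Q)) : Prop :=
  forall s1 e f s2, s = s1 ++ [:: e, f & s2] -> f <> inv e.

Definition reduced_closed_path Q (s : seq (edge Q)) : Prop :=
  is_path (base Q) s (base Q) /\ reduced_path s.

Definition deterministic Q : Prop :=
  forall e f : edge Q, label e = label f -> src e = src f \/ tgt e = tgt f ->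
    e = f.

Definition connected Q : Prop :=
  forall p q : vertex Q, exists s, is_path p s q.

Definition trim Q : Prop :=
  (forall p : vertex Q, exists s1 s2,
     reduced_closed_path (s1 ++ s2) /\ is_path (base Q) s1 p) /\
  (forall e : edge Q, exists s1 s2, reduced_closed_path (s1 ++ e :: s2)).

Definition stallings Q : Prop :=
  [/\ connected Q, deterministic Q & trim Q].

Record hom Q R := Hom {
  vmap : vertex Q -> vertex R;
  emap : edge Q -> edge R;
  src_emap : forall e, src (emap e) = vmap (src e);
  tgt_emap : forall e, tgt (emap e) = vmap (tgt e);
  label_emap : forall e, label (emap e) = label e;
  vmap_base : vmap (base Q) = base R
}.

Definition hom_onto Q R (theta : hom Q R) : Prop :=
  range (vmap theta) = setT /\ range (emap theta) = setT.

End Automata.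

Section Onto.
Variable G : groupType.
Implicit Types H K L X : set G.

Definition language X (Q : automaton X) : set G :=
  [set g | exists s : seq (edge Q),
     reduced_closed_path s /\ g = wval (map (@label _ Q) s)].

Definition is_stallings_of X H (Q : automaton X) : Prop :=
  stallings Q /\ language Q = H.

(* theta_{H,K} : Gamma_X(H) -> Gamma_X(K) is onto.  The two automata are
   determined by X, H, K up to isomorphism and there is a single homomorphism
   between them, so the choice of representatives is immaterial. *)
Definition theta_onto X H K : Prop :=
  exists (QH QK : automaton X) (theta : hom QH QK),
    [/\ is_stallings_of H QH, is_stallings_of K QK & hom_onto theta].

Definition onto H K : Prop :=
  extension H K /\ (forall X, basis setT X -> theta_onto X H K).

End Onto.

(* G is F_A.  The inclusion of F_A in F_B, for an alphabet B containing A, is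
   given up to isomorphism by an injective morphism phi from G to a group free
   on B that maps A into B. *)
Definition fully_onto (G : groupType) (A H K : set G) : Prop :=
  extension H K /\
  (forall (G' : groupType) (B : set G') (phi : {multiplicative G -> G'}),
     basis setT B -> injective phi -> phi @` A `<=` B ->
     forall B' : set G', basis setT B' ->
       theta_onto B' (phi @` H) (phi @` K)).

Section Closures.
Variable G : groupType.
Implicit Types A H K L : set G.

Definition is_algebraic_closure K H L : Prop :=
  [/\ is_subgroup L, H `<=` L, L `<=` K, algebraic H L & free_factor K L].

(* Definite description: the default set0 is not a subgroup, hence never a free
   factor; it is returned if there is not exactly one such L. *)
Definition Cl K H : set G :=
  xget set0 [set L | unique (is_algebraic_closure K H) L].

Definition OCl K H : set G :=
  generated (\bigcup_(L in [set L | onto H L /\ L `<=` K]) L).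

Definition fOCl A K H : set G :=
  generated (\bigcup_(L in [set L | fully_onto A H L /\ L `<=` K]) L).

End Closures.

(* Main.v *)
Require Import Defs.
From mathcomp Require Import all_boot.
From mathcomp Require Import boolp classical_sets functions cardinality.

(* With L minimal among the free factors of F containing H, the extension H <= L is
   algebraic.  Algebraic extensions are fully onto: the image of Gamma(H) in Gamma(L)
   is a connected subgraph of Gamma(L), hence its fundamental group is a free factor
   of L; it contains H, so it is L, and Gamma(L) being trim the image is everything.
   Fully onto extensions are onto.  Finally an onto extension M of H lies in L: for a
   basis of F extending a basis of L, the labels occurring in Gamma(H) belong to the
   basis of L, and Gamma(H) maps onto Gamma(M). *)

Set Implicit Arguments.
Unset Strict Implicit.
Unset Printing Implicit Defensive.

Local Open Scope group_scope.
Local Open Scope classical_set_scope.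

(** * Words *)

(** The bases met in full ontoness may be infinite and K need not be finitely generated, so
    Gamma_X(K) is not obtained by folding. It is taken as the core of the Schreier graph of right
    cosets of K, with spanning trees given by choice. That a subgraph yields a free factor comes
    from Schreier generators: a tree spanning the image of Gamma(H) is extended to the whole graph,
    and the generators of the edges of the image are then part of a basis of K. Freeness is always
    proved by van der Waerden's trick: the group acts on reduced words over the candidate basis, and
    a nonempty reduced word moves the empty one. Minimality of L is not reached by a descending
    chain. The number of basis elements lying outside the factor is maximised instead; it is bounded
    by the size of A, since homomorphisms to Z/2 can be counted on either generating set. *)

Lemma flipK (C : Type) : involutive (@flip C).
Proof. by case=> c b; rewrite /flip /= negbK. Qed.

Section Words.
Variable C : eqType.
Implicit Types (x y : letter C) (w r : seq (letter C)).

(** Multiplication by a letter on normal forms. On reduced words [push x] is a bijection with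
    inverse [push (flip x)], so that words act on [rword]. *)
Definition push x r :=
  if r is y :: r' then if y == flip x then r' else x :: r else [:: x].

Definition reduce w := foldr push [::] w.

Definition winv w := rev (map (@flip C) w).

Lemma flip_eqC x y : (y == flip x) = (x == flip y).
Proof. by apply/eqP/eqP => ->; rewrite flipK. Qed.

Lemma winvK : involutive winv.
Proof.
by move=> w; rewrite /winv map_rev revK -map_comp map_id_in // => x _ /=; exact: flipK.
Qed.

Lemma winv_cat w1 w2 : winv (w1 ++ w2) = winv w2 ++ winv w1.
Proof. by rewrite /winv map_cat rev_cat. Qed.

Lemma reduced_winv w : reduced_word w -> reduced_word (winv w).
Proof.
rewrite /reduced_word /winv rev_sorted sorted_map => h.
apply: sub_sorted h => x y /=; rewrite flipK.
by rewrite eq_sym.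
Qed.

Lemma reduced_push x r : reduced_word r -> reduced_word (push x r).
Proof.
case: r => [//|y r] /= h; case: ifP => [_|/negbT h1]; first exact: path_sorted h.
by rewrite /= h1.
Qed.

Lemma push_flipK x r : reduced_word r -> push (flip x) (push x r) = r.
Proof.
case: r => [|y r] /= h; first by rewrite flipK eqxx.
have [yE|_] /= := eqVneq y (flip x); last by rewrite flipK eqxx.
subst y; case: r h => //= z r /andP[h _]; rewrite (negbTE h).
by [].
Qed.

Lemma push_reduced x w : reduced_word (x :: w) -> push x w = x :: w.
Proof. by case: w => //= y w /andP[/negbTE ->]. Qed.

Lemma reduced_reduce w : reduced_word (reduce w).
Proof. by elim: w => //= x w; exact: reduced_push. Qed.

Lemma reduce_reduced w : reduced_word w -> reduce w = w.
Proof.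
elim: w => //= x w IH h; rewrite IH; first exact: push_reduced.
exact: path_sorted h.
Qed.

Definition rword := {r : seq (letter C) | reduced_word r}.

Definition rnil : rword := exist _ [::] isT.

Definition rpush x (r : rword) : rword :=
  exist _ (push x (val r)) (reduced_push x (valP r)).

Lemma rpush_flipK x (r : rword) : rpush (flip x) (rpush x r) = r.
Proof. by apply: val_inj; apply: push_flipK (valP r). Qed.

Lemma rpush_flipVK x (r : rword) : rpush x (rpush (flip x) r) = r.
Proof. by have := rpush_flipK (flip x) r; rewrite flipK. Qed.

Lemma foldr_rpush_winv w (r : rword) : foldr rpush (foldr rpush r w) (winv w) = r.
Proof.
elim: w r => //= x w IH r.
by rewrite /winv /= rev_cons foldr_rcons rpush_flipK -/(winv w) IH.
Qed.

Lemma val_foldr_rpush w (r : rword) : val (foldr rpush r w) = foldr push (val r) w.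
Proof. by elim: w => //= x w ->. Qed.

(** If [winv w] sends [w'] to the empty word, then acting back by [w] sends the empty word to [w'];
    but it also sends it to [w], which is reduced. *)
Lemma reduce_winv_cat_nil w w' : reduced_word w -> reduced_word w' ->
  reduce (winv w ++ w') = [::] -> w = w'.
Proof.
move=> hw hw' e.
pose r' : rword := exist _ w' hw'.
have h : foldr rpush r' (winv w) = rnil.
  apply: val_inj; rewrite val_foldr_rpush /=.
  by rewrite /reduce foldr_cat -/(reduce w') reduce_reduced in e.
have := foldr_rpush_winv (winv w) r'; rewrite h winvK => /(congr1 val).
by rewrite val_foldr_rpush /= => <-; rewrite -/(reduce w) reduce_reduced.
Qed.

(** Groups will act on the right, so letters get pushed in reading order and the word is spelled
    backwards. *)
Lemma foldl_rpush_reduced w (r : rword) : reduced_word (catrev w (val r)) ->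
  val (foldl (fun (r : rword) x => rpush x r) r w) = catrev w (val r).
Proof.
elim: w r => //= x w IH r h.
have hx : reduced_word (x :: val r).
  move: h; rewrite catrevE /reduced_word.
  by case/cat_sorted2.
by rewrite IH /= push_reduced.
Qed.

End Words.

(** * Free bases *)

Section Subgroup.
Variable G : groupType.
Implicit Types (H K X Y : set G) (g h : G).

Lemma subgroup1 H : is_subgroup H -> H 1.
Proof. by case. Qed.

Lemma subgroupM H g h : is_subgroup H -> H g -> H h -> H (g * h).
Proof. by case=> _ [hM _]; exact: hM. Qed.

Lemma subgroupV H g : is_subgroup H -> H g -> H g^-1.
Proof. by case=> _ [_ hV]; exact: hV. Qed.

Lemma subgroup_setT : is_subgroup [set: G].
Proof. by split; [|split]. Qed.

Lemma generated_subgroup X : is_subgroup (generated X).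
Proof.
split; first by move=> K [/subgroup1].
split=> [g h hg hh|g hg] K KX; have [hK _] := KX.
- by apply: subgroupM (hg _ KX) (hh _ KX).
- by apply: subgroupV (hg _ KX).
Qed.

Lemma sub_generated X : X `<=` generated X.
Proof. exact: sub_gen_smallest. Qed.

Lemma generated_sub X K : is_subgroup K -> X `<=` K -> generated X `<=` K.
Proof. exact: smallest_sub. Qed.

Lemma generatedS X Y : X `<=` Y -> generated X `<=` generated Y.
Proof.
move=> XY; apply: generated_sub (generated_subgroup Y) _.
exact: subset_trans XY (@sub_generated Y).
Qed.

Lemma basis_subgroup K X : basis K X -> is_subgroup K.
Proof. by case=> <- _; exact: generated_subgroup. Qed.

Lemma basis_sub K X : basis K X -> X `<=` K.
Proof. by case=> <- _; exact: sub_generated. Qed.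

End Subgroup.

Section Evaluation.
Variables (G : groupType) (X : set G).
Implicit Types (x : letter X) (w r : seq (letter X)) (g : G).

Definition lval x : G := if x.2 then val x.1 else (val x.1)^-1.

Definition elt g (Xg : X g) : X := exist _ g (mem_set Xg).

Lemma lval_flip x : lval (flip x) = (lval x)^-1.
Proof. by case: x => x [] //; rewrite /lval /= invgK. Qed.

Lemma wval_nil : wval ([::] : seq (letter X)) = 1.
Proof. by rewrite /wval big_nil. Qed.

Lemma wval_cons x w : wval (x :: w) = lval x * wval w.
Proof. by rewrite /wval big_cons. Qed.

Lemma wval_cat w1 w2 : wval (w1 ++ w2) = wval w1 * wval w2.
Proof. by rewrite /wval big_cat. Qed.

Lemma wval1 x : wval [:: x] = lval x.
Proof. by rewrite wval_cons wval_nil mulg1. Qed.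

Lemma wval_rcons w x : wval (rcons w x) = wval w * lval x.
Proof. by rewrite -cats1 wval_cat wval1. Qed.

Lemma wval_winv w : wval (winv w) = (wval w)^-1.
Proof.
elim: w => [|x w IH]; first by rewrite wval_nil invg1.
by rewrite /winv /= rev_cons wval_rcons -/(winv w) IH lval_flip wval_cons invgM.
Qed.

Lemma wval_push x w : wval (push x w) = lval x * wval w.
Proof.
case: w => [|y w] /=; first by rewrite wval1 wval_nil mulg1.
case: eqP => [->|_]; last by rewrite !wval_cons.
by rewrite wval_cons lval_flip mulVKg.
Qed.

Lemma wval_reduce w : wval (reduce w) = wval w.
Proof. by elim: w => //= x w IH; rewrite wval_push IH wval_cons. Qed.

Lemma lval_sub K x : is_subgroup K -> X `<=` K -> K (lval x).
Proof.
move=> hK XK; have hx := XK _ (set_valP x.1); case: x hx => x [] //= hx.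
exact: subgroupV hx.
Qed.

Lemma wval_sub K w : is_subgroup K -> X `<=` K -> K (wval w).
Proof.
move=> hK XK; elim: w => [|x w IH]; first by rewrite wval_nil; exact: subgroup1.
by rewrite wval_cons; apply: subgroupM IH => //; exact: lval_sub.
Qed.

Lemma generatedP g : generated X g <->
  exists w, reduced_word w /\ wval w = g.
Proof.
split=> [|[w [_ <-]]]; last first.
  by apply: wval_sub; [exact: generated_subgroup | exact: sub_generated].
apply: (@generated_sub _ _ [set g | exists w, reduced_word w /\ wval w = g]).
- split; first by exists [::]; rewrite wval_nil.
  split=> [_ _ [w [hw <-]] [w' [hw' <-]]|_ [w [hw <-]]].
  + exists (reduce (w ++ w')); rewrite wval_reduce wval_cat; split=> //.
    exact: reduced_reduce.
  + by exists (winv w); rewrite wval_winv; split=> //; exact: reduced_winv.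
- by move=> x Xx; exists [:: (elt Xx, true)]; rewrite wval1.
Qed.

Lemma basis_word K g : basis K X -> K g -> exists w, reduced_word w /\ wval w = g.
Proof. by case=> <- _ /generatedP. Qed.

Lemma basis_wval_inj K w w' : basis K X -> reduced_word w -> reduced_word w' ->
  wval w = wval w' -> w = w'.
Proof.
move=> [_ hX] hw hw' e; apply: reduce_winv_cat_nil => //.
apply: hX; first exact: reduced_reduce.
by rewrite wval_reduce wval_cat wval_winv e mulVg.
Qed.

End Evaluation.

Section Multiplicative.
Variables (G G' : groupType) (phi : {multiplicative G -> G'}).

Lemma multiplicative1 : phi 1 = 1.
Proof. by apply: (@mulgI _ (phi 1)); rewrite -gmulfM !mulg1. Qed.

Lemma multiplicativeV g : phi g^-1 = (phi g)^-1.
Proof. by symmetry; apply: mulg1_eq; rewrite -gmulfM mulgV multiplicative1. Qed.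

End Multiplicative.

Section MapLetters.

Definition lmap (C D : Type) (f : C -> D) (x : letter C) : letter D := (f x.1, x.2).

Lemma lmap_inj (C D : Type) (f : C -> D) : injective f -> injective (lmap f).
Proof. by move=> fI [x b] [y c] [/fI -> ->]. Qed.

Lemma reduced_lmap (C D : eqType) (f : C -> D) (w : seq (letter C)) : injective f ->
  reduced_word (map (lmap f) w) = reduced_word w.
Proof.
move=> fI; rewrite /reduced_word sorted_map; apply: eq_sorted => x y /=.
by rewrite -[flip (lmap f x)]/(lmap f (flip x)) (inj_eq (lmap_inj fI)).
Qed.

Lemma wval_lmap (G G' : groupType) (phi : {multiplicative G -> G'})
    (X : set G) (Y : set G') (f : X -> Y) (w : seq (letter X)) :
  (forall x, val (f x) = phi (val x)) -> wval (map (lmap f) w) = phi (wval w).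
Proof.
move=> fE; elim: w => [|x w IH]; first by rewrite /= !wval_nil multiplicative1.
rewrite /= !wval_cons gmulfM IH; congr (_ * _).
by case: x => x [] /=; rewrite /lval /= fE ?multiplicativeV.
Qed.

Variables (G : groupType) (X Y : set G) (XY : X `<=` Y).

Definition incl (x : X) : Y := elt (XY (set_valP x)).

Lemma incl_inj : injective incl.
Proof. by move=> x y /(congr1 val) /= /val_inj. Qed.

Lemma wval_incl w : wval (map (lmap incl) w) = wval w.
Proof. exact: (@wval_lmap _ _ idfun). Qed.

Lemma basis_subset K : basis K Y -> basis (generated X) X.
Proof.
move=> [_ hY]; split=> // w hw e.
have : map (lmap incl) w = [::].
  by apply: hY; rewrite ?wval_incl // reduced_lmap //; exact: incl_inj.
by case: w {hw e}.
Qed.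

(** The value also has a reduced word over X, and reduced words over Y are unique. *)
Lemma reduced_word_letters K (w : seq (letter Y)) : basis K Y -> reduced_word w ->
  generated X (wval w) -> forall x, x \in w -> X (val x.1).
Proof.
move=> hY hw /generatedP [w' [hw' e]] x.
have -> : w = map (lmap incl) w'.
  apply: basis_wval_inj hY hw _ _; last by rewrite wval_incl.
  by rewrite reduced_lmap //; exact: incl_inj.
by case/mapP => y _ -> /=; exact: set_valP.
Qed.

Lemma basis_generated_mem K g : basis K Y -> Y g -> generated X g -> X g.
Proof.
move=> hY Yg gg.
have gw : generated X (wval [:: (elt Yg, true)]) by rewrite wval1.
exact: (reduced_word_letters hY _ gw (mem_head _ _)).
Qed.

End MapLetters.

(** Each letter of X lies in N, hence in the range of [phi], so words over X lift letter by letter;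
    relations are transported by injectivity. *)
Lemma basis_preimage (G G' : groupType) (phi : {multiplicative G -> G'})
    (N X : set G') : injective phi -> N `<=` range phi -> basis N X ->
  basis (phi @^-1` N) (phi @^-1` X).
Proof.
move=> phiI Nphi hX; have XN := basis_sub hX.
pose f (x : phi @^-1` X) : X := elt (set_valP x : X (phi (val x))).
have fI : injective f by move=> x y /(congr1 val) /= /phiI /val_inj.
split.
- apply/seteqP; split.
    apply: generated_sub => [|x /XN //]; have hN := basis_subgroup hX.
    split; first by rewrite /preimage /= multiplicative1; exact: subgroup1.
    by split=> [x y hx hy|x hx]; rewrite /preimage /= ?gmulfM ?multiplicativeV;
      [exact: subgroupM | exact: subgroupV].
  move=> g Ng; have [w [_ e]] := basis_word hX Ng.
  elim: w g {Ng} e => [|x w IH] g.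
    rewrite wval_nil -(multiplicative1 phi) => /phiI <-.
    exact: subgroup1 (generated_subgroup _).
  rewrite wval_cons => e.
  have [y _ ey] := Nphi _ (XN _ (set_valP x.1)).
  have Xy : (phi @^-1` X) y by rewrite /preimage /= ey; exact: set_valP.
  pose z : G := if x.2 then y else y^-1.
  have ez : phi z = lval x by rewrite /z /lval -ey; case: (x.2); rewrite ?multiplicativeV.
  have -> : g = z * (z^-1 * g) by rewrite mulVKg.
  have hG := generated_subgroup (phi @^-1` X); apply: (subgroupM hG).
    by rewrite /z; case: (x.2); [|apply: (subgroupV hG)]; exact: sub_generated.
  by apply: IH; rewrite gmulfM multiplicativeV ez -e mulKg.
- move=> w hw e; have : map (lmap f) w = [::].
    case: hX => _; apply; first by rewrite reduced_lmap.
    by rewrite (wval_lmap (phi := phi)) // e multiplicative1.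
  by case: w {hw e}.
Qed.

(** * Right actions and freeness *)

Section WordAction.
Variables (C : eqType) (S : Type) (a : letter C -> S -> S).

Definition wact (w : seq (letter C)) (s : S) : S := foldl (fun s x => a x s) s w.

Lemma wact_cat w1 w2 s : wact (w1 ++ w2) s = wact w2 (wact w1 s).
Proof. exact: foldl_cat. Qed.

Hypothesis aK : forall x s, a (flip x) (a x s) = s.

Lemma wact_reduce w s : wact (reduce w) s = wact w s.
Proof.
elim: w s => //= x w IH s; rewrite -IH; case: (reduce w) => //= y r.
by case: eqP => //= ->; rewrite aK.
Qed.

End WordAction.

(** A right action, with multiplicativity required on K only: subgroups are subsets of an ambient
    group, and an action of K need not extend to it. *)
Definition is_act (G : groupType) (K : set G) (S : Type) (act : G -> S -> S) :=
  (forall s, act 1 s = s) /\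
  forall g h s, K g -> K h -> act (g * h) s = act h (act g s).

Section Actions.
Variables (G : groupType) (S : Type).
Implicit Types (K X : set G) (act : G -> S -> S).

Lemma is_actS K K' act : K `<=` K' -> is_act K' act -> is_act K act.
Proof. by move=> KK' [a1 aM]; split=> // g h s /KK' hg /KK' hh; exact: aM. Qed.

Lemma is_actV K act g s : is_subgroup K -> is_act K act -> K g ->
  act g (act g^-1 s) = s.
Proof.
move=> hK [a1 aM] Kg.
by rewrite -aM ?mulVg //; exact: subgroupV.
Qed.

Lemma is_actKV K act g s : is_subgroup K -> is_act K act -> K g ->
  act g^-1 (act g s) = s.
Proof.
move=> hK hA Kg; have := is_actV s hK hA (subgroupV hK Kg).
by rewrite invgK.
Qed.

(** The universal property of a free basis, for actions: an element of K acts through its reduced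
    word. *)
Lemma free_act K X (a : letter X -> S -> S) : basis K X ->
  (forall x s, a (flip x) (a x s) = s) ->
  exists act, is_act K act /\ forall w s, act (wval w) s = wact a w s.
Proof.
move=> hX aK.
have /choice[nf nfE] : forall g, exists w : seq (letter X),
    K g -> reduced_word w /\ wval w = g.
  by move=> g; case: (pselect (K g)) => [/(basis_word hX) [w hw]|]; [exists w | exists [::]].
pose act g s := wact a (nf g) s.
have actE w s : act (wval w) s = wact a w s.
  have Kw : K (wval w) by apply: wval_sub; [exact: basis_subgroup hX | exact: basis_sub].
  have [h1 h2] := nfE _ Kw.
  rewrite /act -(wact_reduce aK w); congr wact.
  by apply: basis_wval_inj hX h1 (reduced_reduce w) _; rewrite wval_reduce.
exists act; split=> //; split=> [s|g h s Kg Kh].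
  by rewrite -(wval_nil X) actE.
have [_ {1}<-] := nfE _ Kg; have [_ {1}<-] := nfE _ Kh.
by rewrite -wval_cat actE wact_cat.
Qed.

Lemma act_ext K X act1 act2 : is_subgroup K -> is_act K act1 -> is_act K act2 ->
  X `<=` K -> (forall g s, X g -> act1 g s = act2 g s) ->
  forall g s, generated X g -> act1 g s = act2 g s.
Proof.
move=> hK h1 h2 XK e g s gX.
suff [_ ->] : [set g | K g /\ forall s, act1 g s = act2 g s] g by [].
apply: (generated_sub _ _ gX) => [|x Xx]; last by split=> [|t]; [exact: XK | exact: e].
split; first by split; [exact: subgroup1 | move=> t; rewrite h1.1 h2.1].
split=> [x y [Kx ex] [Ky ey]|x [Kx ex]]; (split; last move=> t).
- exact: subgroupM.
- by rewrite h1.2 // h2.2 // ex ey.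
- exact: subgroupV.
- by rewrite -{1}(is_actV t hK h2 Kx) -ex (is_actKV _ hK h1 Kx).
Qed.

(* Acting by a word on an injective copy of the reduced words spells that word,
   so that no nonempty reduced word acts trivially. *)
Lemma free_of_act (Z : set G) act (i : rword Z -> S) :
  is_act (generated Z) act -> injective i ->
  (forall (z : Z) r, act (val z) (i r) = i (rpush (z, true) r)) ->
  basis (generated Z) Z.
Proof.
move=> hA iI actE; split=> // w hw e.
have gZ (z : Z) : generated Z (val z) by apply: sub_generated; exact: set_valP.
have hZ := generated_subgroup Z.
have actL (x : letter Z) r : act (lval x) (i r) = i (rpush x r).
  case: x => z []; rewrite /lval; first exact: actE.
  by rewrite -{1}(rpush_flipVK (z, true) r) -actE (is_actKV _ hZ hA).
have actW r : act (wval w) (i r) = i (foldl (fun (r : rword Z) x => rpush x r) r w).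
  elim: w r {hw e} => [|x w IH] r; first by rewrite wval_nil hA.1.
  rewrite wval_cons hA.2 ?actL ?IH //.
    by apply: lval_sub => //; exact: sub_generated.
  by apply: wval_sub => //; exact: sub_generated.
have := actW (rnil Z); rewrite e hA.1 => /iI /(congr1 val).
rewrite foldl_rpush_reduced /= => [h|].
  by apply: (can_inj revK); rewrite -[rev w]/(catrev w [::]) -h.
rewrite -[catrev w [::]]/(rev w) /reduced_word rev_sorted.
apply: sub_sorted hw => x y /=.
by apply: contraNN; rewrite flip_eqC.
Qed.

End Actions.

(** * Free factors *)

Section FreeFactors.
Variable G : groupType.
Implicit Types H K L X Y Z : set G.

(* Every choice of parities on [s] extends to a homomorphism from [K] to Z/2,
   which is determined by its values on [a]. *)
Lemma rank_bound K Z (a s : seq G) : basis K Z -> generated [set` a] = K ->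
  uniq s -> (forall g, g \in s -> Z g) -> (size s <= size a)%N.
Proof.
move=> hZ hK us sZ.
pose act0 (f : G -> bool) (x : letter Z) b := b (+) f (val x.1).
have act0K f x b : act0 f (flip x) (act0 f x b) = b by rewrite /act0 -addbA addbb addbF.
have /choice[act actP] f := free_act hZ (act0K f).
have act_addb f g b : K g -> act f g b = b (+) act f g false.
  move=> /(basis_word hZ) [w [_ <-]]; rewrite !(actP f).2.
  elim: w b => [|x w IH] b; first by rewrite /= addbF.
  by rewrite /= IH [in RHS]IH addbA.
(* For [g] outside [s] the index is [size s], so the default gives such letters parity 0. *)
pose fun_of (t : (size s).-tuple bool) g := nth false t (index g s).
pose phi t : (size a).-tuple bool :=
  [tuple of map (fun g => act (fun_of t) g false) (in_tuple a)].
have phiI : injective phi.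
  move=> t t' /(congr1 val) /= /eq_in_map ett'.
  have aK : [set` a] `<=` K by rewrite -hK; exact: sub_generated.
  have act_eq g : K g -> act (fun_of t) g false = act (fun_of t') g false.
    move=> Kg; apply: (act_ext (basis_subgroup hZ) (actP _).1 (actP _).1 aK).
      move=> x b ax; have Kx := aK _ ax.
      by rewrite (act_addb _ _ b Kx) (act_addb (fun_of t') _ b Kx) ett'.
    by rewrite hK.
  apply: eq_from_tnth => i; rewrite !(tnth_nth false).
  have hi : nth 1 s i \in s by exact: mem_nth.
  have act_s u : act (fun_of u) (nth 1 s i) false = nth false u i.
    have := (actP (fun_of u)).2 [:: (elt (sZ _ hi), true)] false.
    by rewrite wval1 /= /act0 /fun_of /= index_uniq.
  by rewrite -!act_s act_eq //; apply: basis_sub hZ _ (sZ _ hi).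
have := leq_card phi phiI.
by rewrite !card_tuple card_bool leq_exp2l.
Qed.

(* The group acts on the words in the new basis: <X> through its basis Y, and the
   remaining letters of Z by themselves. *)
Lemma basis_exchange K Z X Y : X `<=` Z -> basis K Z -> basis (generated X) Y ->
  basis K (Y `|` (Z `\` X)).
Proof.
move=> XZ hZ hY; set N := Y `|` (Z `\` X).
have YK : Y `<=` K.
  by apply: subset_trans (basis_sub hY) _; case: hZ => <- _; exact: generatedS.
have hN : generated N = K.
  apply/seteqP; split.
    apply: generated_sub; first exact: basis_subgroup hZ.
    by move=> g [/YK //|[Zg _]]; exact: basis_sub hZ _ Zg.
  case: hZ => <- _; apply: generated_sub; first exact: generated_subgroup.
  move=> g Zg; have [Xg|nXg] := pselect (X g); last by apply: sub_generated; right.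
  have : generated Y g by case: hY => -> _; exact: sub_generated.
  by apply: generatedS => y Yy; left.
have YN : Y `<=` N by move=> y Yy; left.
have [actX [hX actXE]] := free_act (a := fun x => rpush (lmap (incl YN) x)) hY
  (fun x r => rpush_flipK (lmap (incl YN) x) r).
pose actZ (x : letter Z) : rword N -> rword N :=
  match pselect (X (val x.1)) with
  | left _ => actX (lval x)
  | right nX => rpush (elt (or_intror (conj (set_valP x.1) nX) : N (val x.1)), x.2)
  end.
have actZK x r : actZ (flip x) (actZ x r) = r.
  case: x => x b; rewrite /actZ /=; case: pselect => [Xx|nXx]; last exact: rpush_flipK.
  rewrite lval_flip (is_actKV _ (generated_subgroup X) hX) //.
  rewrite /lval; case: b => /=; first exact: sub_generated.
  by apply: subgroupV (generated_subgroup X) _; exact: sub_generated.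
have [act [hA actE]] := free_act hZ actZK.
have XK : generated X `<=` K by case: hZ => <- _; exact: generatedS.
have actX_eq g r : generated X g -> act g r = actX g r.
  move: g r; apply: (act_ext (generated_subgroup X) (is_actS XK hA) hX (@sub_generated _ X)).
  move=> g r Xg; have := actE [:: (elt (XZ _ Xg), true)] r.
  by rewrite wval1 /= /actZ /=; case: pselect.
rewrite -hN.
apply: (free_of_act (act := act) (i := id)); first by rewrite hN.
  by [].
move=> z r; case: (set_valP z) => [Yz|[Zz nXz]].
- rewrite actX_eq; last exact: basis_sub hY _ Yz.
  have := actXE [:: (elt Yz, true)] r; rewrite wval1 /= => ->.
  by congr (rpush (_, _) _); exact: val_inj.
- have := actE [:: (elt Zz, true)] r; rewrite wval1 /= /actZ /=.
  case: pselect => // nXz'; rewrite [lval _]/= => ->.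
  by congr (rpush (_, _) _); exact: val_inj.
Qed.

Lemma free_factor_of_basis K X Y : X `<=` Y -> basis K Y -> free_factor K (generated X).
Proof. by move=> XY hY; exists X, Y; split=> //; exact: basis_subset hY. Qed.

(** Among the free factors of K containing H, one is taken whose complementary basis part contains
    the longest list [s]; [rank_bound] bounds that length. A proper free factor of it containing H
    would, by [basis_exchange], allow a longer list. *)
Lemma algebraic_closure_exists K H Z (a : seq G) :
  basis K Z -> generated [set` a] = K -> is_subgroup H -> H `<=` K ->
  exists L, is_algebraic_closure K H L.
Proof.
move=> hZ ha hH HK.
pose P n := exists X Y (s : seq G), [/\ X `<=` Y, basis K Y, H `<=` generated X
  & [/\ uniq s, forall g, g \in s -> (Y `\` X) g & size s = n]].
have P0 : exists n, `[<P n>].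
  by exists 0%N; apply/asboolP; exists Z, Z, [::]; split=> //; case: hZ => ->.
have Pa n : `[<P n>] -> (n <= size a)%N.
  move=> /asboolP [X [Y [s [_ hY _ [us sY <-]]]]].
  by apply: rank_bound hY ha us _ => g /sY [].
have [n /asboolP [X [Y [s [XY hY HX [us sY sn]]]]] nmax] := ex_maxnP P0 Pa.
have XK : generated X `<=` K by case: hY => <- _; exact: generatedS.
exists (generated X); split=> //;
  [exact: generated_subgroup | | exact: free_factor_of_basis hY].
split; first by split=> //; exact: generated_subgroup.
move=> L [X' [Y' [XY' hX' hY']]] HL.
(* Either L is the whole of [generated X], or some [y] of its basis [Y'] lies outside [X'] and can
   be added to [s]. *)
have [Y'X'|/existsNP [y /not_implyP [Y'y nX'y]]] := pselect (Y' `<=` X').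
  case: hX' => <- _; case: hY' => <- _; congr generated.
  by apply/seteqP; split.
have hN := basis_exchange XY hY hY'.
have ys : y \notin s.
  apply/negP => /sY [Yy nXy]; apply: nXy; apply: (basis_generated_mem XY hY Yy).
  exact: basis_sub hY' _ Y'y.
suff : (n.+1 <= n)%N by rewrite ltnn.
apply: nmax; apply/asboolP; exists X', (Y' `|` (Y `\` X)), (y :: s); split=> //.
- by move=> x /XY' ?; left.
- by case: hX' => ->.
split; rewrite /= ?ys ?sn // => g; rewrite inE => /predU1P [->|gs].
  by split=> //; left.
split; first by right; exact: sY.
have [Yg nXg] := sY _ gs => X'g; apply: nXg; apply: (basis_generated_mem XY hY Yg).
by apply: basis_sub hY' _ (XY' _ X'g).
Qed.

End FreeFactors.

(** * Subgraphs of the Schreier graph *)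

Section Trees.
Variables (V L : Type).

Inductive reach (D : set V) (E : V -> L -> V -> Prop) : V -> Prop :=
| Reach0 v : D v -> reach D E v
| ReachS u x v : reach D E u -> E u x v -> reach D E v.

(** A breadth-first forest, encoded by the labels [t v] of the tree path to [v]. The roots D carry
    prescribed labels [t0], so that a tree built on a subgraph can be prolonged. *)
Lemma tree_extend (D : set V) (E : V -> L -> V -> Prop) (t0 : V -> seq L) :
  exists t : V -> seq L, (forall v, D v -> t v = t0 v) /\
    forall v, reach D E v ->
      D v \/ exists u x, [/\ reach D E u, E u x v & t v = rcons (t u) x].
Proof.
pose dep := fix dep (n : nat) (v : V) {struct n} : Prop :=
  if n is n'.+1 then exists u x, dep n' u /\ E u x v else D v.
have dep_reach n v : dep n v -> reach D E v.
  elim: n v => [|n IH] v /=; first exact: Reach0.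
  by move=> [u [x [/IH ru e]]]; exact: ReachS ru e.
(* [m v] is the distance from D; a chosen parent is one step closer, which lets [tn] recurse on the
   distance. *)
have /choice[m mP] : forall v, exists n, reach D E v ->
    dep n v /\ forall k, dep k v -> (n <= k)%N.
  move=> v; have [rv|] := pselect (reach D E v); last by exists 0%N.
  have ex : exists n, `[<dep n v>].
    elim: rv => [u Du|u x w _ [n /asboolP du] e]; first by exists 0%N; apply/asboolP.
    by exists n.+1; apply/asboolP; exists u, x.
  case: (ex_minnP ex) => n /asboolP dn nmin; exists n => _; split=> // k dk.
  by apply: nmin; apply/asboolP.
have /choice[par parP] : forall v, exists p : option (V * L), reach D E v ->
    if m v is n.+1 then exists u x, [/\ p = Some (u, x), E u x v, reach D E u & m u = n]
    else D v.
  move=> v; have [rv|] := pselect (reach D E v); last by exists None.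
  have [dv vmin] := mP _ rv; case: (m v) dv vmin => [|n] /= dv vmin; first by exists None.
  have [u [x [du e]]] := dv; exists (Some (u, x)) => _; exists u, x; split=> //.
    exact: dep_reach du.
  have [du' umin] := mP _ (dep_reach _ _ du); apply/eqP; rewrite eqn_leq umin //=.
  by rewrite -ltnS vmin //=; exists u, x.
pose tn := fix tn (n : nat) (v : V) {struct n} : seq L := if n is n'.+1 then
  if par v is Some (u, x) then rcons (tn n' u) x else [::] else t0 v.
exists (fun v => tn (m v) v); split=> [v Dv|v rv].
  have rv : reach D E v by exact: Reach0.
  have [_ vmin] := mP _ rv; have := vmin 0%N Dv.
  by rewrite leqn0 => /eqP ->.
have := parP _ rv; case: (m v) => [|n]; first by left.
by move=> [u [x [pv e ru mu]]]; right; exists u, x; split=> //=; rewrite pv mu.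
Qed.

End Trees.

Section Cosets.
Variable G : groupType.
Implicit Types (H K v : set G) (g h : G).

(** The right translate v g, that is, the end of the path read from the coset v along a word of
    value g. *)
Definition rtrans v g : set G := [set a | v (a * g^-1)].

Lemma rtrans1 v : rtrans v 1 = v.
Proof. by apply/seteqP; split=> a; rewrite /rtrans /= invg1 mulg1. Qed.

Lemma rtransM v g h : rtrans v (g * h) = rtrans (rtrans v g) h.
Proof. by apply/seteqP; split=> a; rewrite /rtrans /= invgM mulgA. Qed.

Lemma rtransK v g : rtrans (rtrans v g) g^-1 = v.
Proof. by rewrite -rtransM mulgV rtrans1. Qed.

Lemma rtransVK v g : rtrans (rtrans v g^-1) g = v.
Proof. by rewrite -rtransM mulVg rtrans1. Qed.

Lemma rtrans_id K g : is_subgroup K -> rtrans K g = K <-> K g.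
Proof.
move=> hK; split=> [e|Kg].
  by rewrite -e /rtrans /= mulgV; exact: subgroup1.
apply/seteqP; split=> a; rewrite /rtrans /= => h.
  by rewrite -[a](mulgVK g); exact: subgroupM.
by apply: subgroupM => //; exact: subgroupV.
Qed.

(** The product set K v. It sends Hg to Kg when H is contained in K, and so is the vertex map of
    theta. *)
Definition lcos K v : set G := [set b | exists k a, [/\ K k, v a & b = k * a]].

Lemma lcos_rtrans K v g : lcos K (rtrans v g) = rtrans (lcos K v) g.
Proof.
apply/seteqP; split=> b; rewrite /rtrans /lcos /=.
  by move=> [k [a [Kk va ->]]]; exists k, (a * g^-1); rewrite mulgA.
move=> [k [a [Kk va e]]]; exists k, (a * g); split; rewrite ?mulgK //.
by rewrite mulgA -e mulgVK.
Qed.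

Lemma lcos_subgroup H K : is_subgroup H -> is_subgroup K -> H `<=` K -> lcos K H = K.
Proof.
move=> hH hK HK; apply/seteqP; split=> b; rewrite /lcos /=.
  by move=> [k [a [Kk /HK Ka ->]]]; exact: subgroupM.
by move=> Kb; exists b, 1; split; rewrite ?mulg1 //; exact: subgroup1.
Qed.

End Cosets.

Section SchreierGraph.
Variables (G : groupType) (X : set G).
Implicit Types (H K v : set G) (x : letter X) (w : seq (letter X)).
Implicit Type E : set G -> letter X -> Prop.

Fixpoint epath E v w : Prop :=
  if w is x :: w' then E v x /\ epath E (rtrans v (lval x)) w' else True.

Lemma epath_cat E v w1 w2 :
  epath E v (w1 ++ w2) <-> epath E v w1 /\ epath E (rtrans v (wval w1)) w2.
Proof.
elim: w1 v => [|x w1 IH] v /=; first by rewrite wval_nil rtrans1; split=> [|[]].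
rewrite wval_cons rtransM; split=> [[e /IH []]|[[e h] h']] //.
by split=> //; apply/IH.
Qed.

Lemma epath_rcons E v w x :
  epath E v (rcons w x) <-> epath E v w /\ E (rtrans v (wval w)) x.
Proof. by rewrite -cats1 epath_cat /=; split=> [[? []]|[]]. Qed.

Definition esym E := forall v x, E v x -> E (rtrans v (lval x)) (flip x).

Lemma epath_winv E v w : esym E -> epath E v w -> epath E (rtrans v (wval w)) (winv w).
Proof.
move=> sE; elim: w v => [//|x w IH] v /= [e /IH h].
rewrite /winv /= rev_cons epath_rcons -/(winv w) wval_cons rtransM; split=> //.
by rewrite wval_winv rtransK; exact: sE.
Qed.

(** A cancelled pair of letters crosses an edge and returns along it, so removing it leaves a path
    through edges already used. *)
Lemma epath_reduce E v w : epath E v w -> epath E v (reduce w).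
Proof.
elim: w v => [//|x w IH] v /= [e /IH].
case: (reduce w) => [|y r] //=; case: eqP => [->|_] [ey h]; last by split.
by move: h; rewrite lval_flip rtransK.
Qed.

(* The edges of Gamma_X(K) crossed by the image of Gamma_X(H), as pairs of a right
   coset of K and a letter. *)
Definition crossed H K v x := exists w1 w2,
  [/\ reduced_word (w1 ++ x :: w2), H (wval (w1 ++ x :: w2)) & v = rtrans K (wval w1)].

Lemma epath_crossed H K w : reduced_word w -> H (wval w) -> epath (crossed H K) K w.
Proof.
move=> hw Hw.
suff : forall w2 w1, w = w1 ++ w2 -> epath (crossed H K) (rtrans K (wval w1)) w2.
  by move=> /(_ w [::] erefl); rewrite wval_nil rtrans1.
elim=> [//|x w2 IH] w1 e /=; split; first by exists w1, w2; rewrite -e.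
by rewrite -rtransM -wval_rcons; apply: IH; rewrite cat_rcons.
Qed.

Lemma esym_crossed H K : is_subgroup H -> is_subgroup K -> H `<=` K ->
  esym (crossed H K).
Proof.
move=> hH hK HK v x [w1 [w2 [hw Hw ->]]]; exists (winv w2), (winv w1).
have e : winv w2 ++ flip x :: winv w1 = winv (w1 ++ x :: w2).
  by rewrite -cat_rcons winv_cat; congr (_ ++ _); rewrite /winv map_rcons rev_rcons.
rewrite e; split; first exact: reduced_winv.
  by rewrite wval_winv; exact: subgroupV.
have [_ eK] := rtrans_id (wval (w1 ++ x :: w2)) hK.
rewrite -{2}(eK (HK _ Hw)) -cat_rcons wval_cat wval_rcons wval_winv !rtransM.
by rewrite rtransK.
Qed.

End SchreierGraph.

Section SchreierBasis.
Variables (G : groupType) (X : set G) (K : set G).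
Hypotheses (hX : basis [set: G] X) (hK : is_subgroup K).
Implicit Types (v : set G) (x : letter X) (w : seq (letter X)).
Implicit Types E D : set G -> letter X -> Prop.

Let cosets v := exists g, v = rtrans K g.

Lemma cosets_epath v w : cosets v -> epath (fun u _ => cosets u) v w.
Proof.
elim: w v => [//|x w IH] v [g ->] /=; split; first by exists g.
by apply: IH; exists (g * lval x); rewrite rtransM.
Qed.

(** The equation [t (rtrans u (lval x)) = rcons (t u) x] says that (u, x) is a tree edge, so the
    second clause is induction along the tree. The third says that the tree joins K to every vertex
    reached inside D without leaving D. *)
Lemma spanning_tree D : exists t : set G -> seq (letter X),
  [/\ t K = [::],
      forall P : set G -> Prop, P K ->
        (forall u x, cosets u -> P u -> t (rtrans u (lval x)) = rcons (t u) x ->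
           P (rtrans u (lval x))) ->
        forall v, cosets v -> P v &
      forall w, epath D K w -> epath D K (t (rtrans K (wval w)))].
Proof.
pose E1 u x v := D u x /\ v = rtrans u (lval x).
(* A tree is first grown from K inside D, then its vertex set [Delta] serves as roots for the whole
   Schreier graph. *)
have [t1 [t1K t1E]] := tree_extend [set K] E1 (fun=> [::]).
pose Delta := reach [set K] E1.
pose E2 u x v := v = rtrans u (@lval _ X x).
have [t [tD tE]] := tree_extend Delta E2 t1.
have DK : Delta K by exact: Reach0.
have tK : t K = [::] by rewrite tD // t1K.
have parent v : reach Delta E2 v -> v = K \/ exists u x,
    [/\ reach Delta E2 u, v = rtrans u (lval x), t v = rcons (t u) x &
        Delta v -> Delta u /\ D u x].
  move=> rv; have [Dv|nDv] := pselect (Delta v); last first.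
    by case: (tE _ rv) => // -[u [x [ru e tv]]]; right; exists u, x; split.
  case: (t1E _ Dv) => [|[u [x [Du [Dux e] tv]]]]; first by left.
  by right; exists u, x; split; rewrite ?tD //; exact: Reach0.
have reachP v : reach Delta E2 v -> cosets v.
  elim=> [u|u x _ _ [g ->] ->]; last by exists (g * lval x); rewrite rtransM.
  elim=> [_ ->|u' x u'' _ [g ->] [_ ->]]; first by exists 1; rewrite rtrans1.
  by exists (g * lval x); rewrite rtransM.
have Preach v : cosets v -> reach Delta E2 v.
  move=> [g ->]; have [w [_ <-]] := basis_word hX (I : setT g).
  elim/last_ind: w => [|w x IH]; first by rewrite wval_nil rtrans1; exact: Reach0.
  by rewrite wval_rcons rtransM; exact: ReachS IH _.
exists t; split=> // [P PK PS v /Preach rv|w hw].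
- move: {2}(size _) (erefl (size (t v))) => n.
  elim: n v rv => [|n IH] v rv; case: (parent _ rv) => [-> //|[u [x [ru -> tv _]]]];
    rewrite tv size_rcons // => -[sn].
  by apply: PS => //; [exact: reachP | exact: IH].
have Dw : Delta (rtrans K (wval w)).
  elim/last_ind: w hw => [|w x IH]; first by rewrite wval_nil rtrans1.
  by move=> /epath_rcons[/IH h Dx]; apply: (ReachS h (x := x)); rewrite wval_rcons rtransM.
suff : forall v, Delta v -> epath D K (t v) /\ rtrans K (wval (t v)) = v.
  by move=> /(_ _ Dw) [].
move=> v; move: {2}(size _) (erefl (size (t v))) => n {w hw Dw}.
elim: n v => [|n IH] v sv Dv; (case: (parent v) => [|->|[u [x [_ vE tv]]]];
    [exact: Reach0 | by rewrite tK wval_nil rtrans1 |]); move: sv;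
  rewrite tv size_rcons // => -[sn].
move=> /(_ Dv) [Du Dux]; have [h e] := IH _ sn Du.
by rewrite epath_rcons wval_rcons rtransM e vE.
Qed.

Section Generators.
Variable t : set G -> seq (letter X).
Hypothesis tK : t K = [::].
Hypothesis tree_ind : forall P : set G -> Prop, P K ->
  (forall u x, cosets u -> P u -> t (rtrans u (lval x)) = rcons (t u) x ->
     P (rtrans u (lval x))) ->
  forall v, cosets v -> P v.

(** The Schreier generator of an edge: out along the tree, across the edge, back along the tree. It
    is 1 on tree edges. *)
Definition edge_gen v (x : X) : G :=
  wval (t v) * val x * (wval (t (rtrans v (val x))))^-1.

Definition edge_gens E : set G :=
  [set g | exists v (x : X), [/\ E v (x, true), g = edge_gen v x & g <> 1]].

Lemma tree_end v : cosets v -> rtrans K (wval (t v)) = v.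
Proof.
move: v; apply: tree_ind; first by rewrite tK wval_nil rtrans1.
by move=> u x _ e ->; rewrite wval_rcons rtransM e.
Qed.

(** The Schreier generators along the path telescope, inner tree words cancelling; a letter of
    negative sign contributes the inverse generator of the reversed edge. *)
Lemma edge_gens_path E v w : esym E -> epath E v w ->
  generated (edge_gens E) (wval (t v) * wval w * (wval (t (rtrans v (wval w))))^-1).
Proof.
move=> sE; have hE := generated_subgroup (edge_gens E).
have gen_edge u (x : X) : E u (x, true) -> generated (edge_gens E) (edge_gen u x).
  move=> Eux; have [->|ne] := pselect (edge_gen u x = 1); first exact: subgroup1.
  by apply: sub_generated; exists u, x.
elim: w v => [|x w IH] v /=.
  by move=> _; rewrite wval_nil rtrans1 mulg1 mulgV; exact: subgroup1.
move=> [Ex /IH h]; rewrite wval_cons rtransM.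
pose c := wval (t v) * lval x * (wval (t (rtrans v (lval x))))^-1.
suff hc : generated (edge_gens E) c.
  by have := subgroupM hE hc h; rewrite /c !mulgA mulgVK.
rewrite /c; case: x Ex {h c} => x [] Ex; first exact: gen_edge.
have := subgroupV hE (gen_edge _ _ (sE _ _ Ex)).
by rewrite /edge_gen /lval /= rtransVK !invgM invgK mulgA.
Qed.

Lemma edge_gens_sub : edge_gens (fun u _ => cosets u) `<=` K.
Proof.
move=> _ [v [x [cv -> _]]]; apply/(rtrans_id _ hK).
have cx : cosets (rtrans v (val x)).
  by have [g ->] := cv; exists (g * val x); rewrite rtransM.
by rewrite /edge_gen !rtransM tree_end // -{1}(tree_end cx) rtransK.
Qed.

(* The ambient group acts on pairs (coset, reduced word) by crossing an edge of the
   Schreier graph while recording its generator; tree edges record nothing. *)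
Lemma edge_gens_basis : basis K (edge_gens (fun u _ => cosets u)).
Proof.
set Z := edge_gens _.
have sc : esym (fun u (_ : letter X) => cosets u).
  by move=> _ x [g ->]; exists (g * lval x); rewrite rtransM.
have cK : cosets K by exists 1; rewrite rtrans1.
have gZ : generated Z = K.
  apply/seteqP; split; first by apply: generated_sub => //; exact: edge_gens_sub.
  move=> k Kk; have [w [_ e]] := basis_word hX (I : setT k).
  have := edge_gens_path sc (cosets_epath w cK).
  by rewrite e ((rtrans_id k hK).2 Kk) tK wval_nil invg1 mulg1 mul1g.
(* Trivial generators are excluded from Z, so [record] ignores them. *)
pose record b g (r : rword Z) : rword Z :=
  if pselect (Z g) is left h then rpush (elt h, b) r else r.
have record1 b r : record b 1 r = r.
  by rewrite /record; case: pselect => // -[? [? []]].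
(* A negative letter crosses backwards the edge that starts at its end, and records the inverse of
   that generator. *)
pose a (x : letter X) (s : set G * rword Z) : set G * rword Z :=
  if x.2 then (rtrans s.1 (val x.1), record true (edge_gen s.1 x.1) s.2)
  else (rtrans s.1 (val x.1)^-1,
        record false (edge_gen (rtrans s.1 (val x.1)^-1) x.1) s.2).
have aK x s : a (flip x) (a x s) = s.
  case: x s => x [] [v r]; rewrite /a /= ?rtransK ?rtransVK /record;
    case: pselect => // h; congr (_, _).
    exact: (rpush_flipK (_, true)).
  exact: (rpush_flipK (_, false)).
have [act [hA actE]] := free_act hX aK.
have actL x s : act (lval x) s = a x s by rewrite -wval1 actE.
(* Moving along the tree changes only the coset. Hence acting by a whole generator, tree words
   included, records exactly one letter. *)
have act_tree v : cosets v -> forall r, act (wval (t v)) (K, r) = (v, r).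
  move: v; apply: tree_ind => [r|u x cu IH tx r]; first by rewrite tK wval_nil hA.1.
  rewrite tx wval_rcons hA.2 // IH actL.
  case: x tx => x [] tx; rewrite /a /lval /=; congr (_, _).
    by rewrite /edge_gen [t (rtrans _ _)]tx wval_rcons mulgV record1.
  rewrite /edge_gen rtransVK [t (rtrans _ _)]tx wval_rcons.
  by rewrite /lval /= mulgVK mulgV record1.
rewrite -gZ; apply: (free_of_act (act := act) (i := fun r => (K, r))).
- exact: is_actS hA.
- by move=> r r' [].
move=> z r; have Zz := set_valP z.
have [v [x [cv zE _]]] := Zz.
have cx : cosets (rtrans v (val x)).
  by have [g ->] := cv; exists (g * val x); rewrite rtransM.
have actx : act (val x) (v, r) = (rtrans v (val x), rpush (z, true) r).
  rewrite -[val x]/(lval (x, true)) actL /a /= -zE /record; case: pselect => // h.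
  by congr (_, rpush (_, _) _); exact: val_inj.
rewrite [in LHS]zE /edge_gen hA.2 // hA.2 // act_tree // actx.
by rewrite -(act_tree _ cx) (is_actKV _ (@subgroup_setT G) hA).
Qed.

End Generators.

(* The generators of the edges of the image of Gamma(H), for a spanning tree of that
   image extended to the whole Schreier graph, span a free factor of K containing H. *)
Lemma algebraic_crossed H v x : algebraic H K -> crossed K K v x -> crossed H K v x.
Proof.
move=> [[hH _ HK] algH] [w1 [w2 [hw Kw ->]]].
pose D v x := @crossed _ X H K v x.
have sD : esym D by exact: esym_crossed.
have [t [tK tree_ind tD]] := spanning_tree D.
pose Z := edge_gens t D.
have cD u y : D u y -> exists w, epath D K (rcons w y) /\ u = rtrans K (wval w).
  move=> [w [w' [rw Hw ->]]]; exists w; split=> //.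
  by move: (epath_crossed K rw Hw); rewrite -cat_rcons epath_cat => -[].
have ZK : generated Z = K.
  (* Z is part of the Schreier basis of K, and words of H are read inside D, so H lies in the free
     factor spanned by Z. *)
  apply: algH.
    apply: free_factor_of_basis (edge_gens_basis tK tree_ind).
    move=> _ [u [y [Duy -> ne]]]; exists u, y; split=> //.
    by have [w [_ ->]] := cD _ _ Duy; exists (wval w).
  move=> h Hh; have [w [rw e]] := basis_word hX (I : setT h); rewrite -e in Hh.
  have := edge_gens_path (t := t) sD (epath_crossed K rw Hh).
  by rewrite ((rtrans_id _ hK).2 (HK _ Hh)) tK wval_nil invg1 mulg1 mul1g e.
(* The elements of K having some word readable from K inside D form a subgroup containing Z, since
   the tree stays in D; this subgroup is therefore K. *)
have [w [ew [Dw _]]] : [set k | exists w, wval w = k /\ epath D K w /\ K k]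
    (wval (w1 ++ x :: w2)).
  rewrite -ZK in Kw; apply: (generated_sub _ _ Kw).
    split; first by exists [::]; rewrite wval_nil; do 2?split=> //; exact: subgroup1.
    split=> [_ _ [w [<- [Dw Kw']]] [w' [<- [Dw' Kw'']]]|_ [w [<- [Dw Kw']]]].
      exists (w ++ w'); rewrite wval_cat epath_cat ((rtrans_id _ hK).2 Kw').
      by do 2?split=> //; exact: subgroupM.
    exists (winv w); rewrite wval_winv; do 2?split=> //; last exact: subgroupV.
    by rewrite -{1}((rtrans_id _ hK).2 Kw'); exact: epath_winv.
  move=> _ [u [y [Duy -> ne]]]; have [w [Dw uE]] := cD _ _ Duy.
  have cu : cosets u by exists (wval w).
  have uyE : rtrans u (val y) = rtrans K (wval (rcons w (y, true))).
    by rewrite wval_rcons rtransM uE.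
  have cuy : cosets (rtrans u (val y)) by rewrite uyE; exists (wval (rcons w (y, true))).
  exists (rcons (t u) (y, true) ++ winv (t (rtrans u (val y)))).
  rewrite wval_cat wval_rcons wval_winv; split=> //; split.
    rewrite epath_cat epath_rcons wval_rcons rtransM (tree_end tK tree_ind cu).
    split; first by split=> //; rewrite uE; apply: tD; case/epath_rcons: Dw.
    rewrite -{1}(tree_end tK tree_ind cuy); apply: epath_winv sD _.
    by rewrite uyE; exact: tD.
  by apply: (edge_gens_sub tK tree_ind); exists u, y.
(* Reducing [w] keeps it inside D and gives [w1 ++ x :: w2], so the edge at [x] belongs to D. *)
have := epath_reduce Dw.
rewrite (basis_wval_inj hX (reduced_reduce w) hw); last by rewrite wval_reduce.
by rewrite epath_cat /= => -[_ []].
Qed.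

End SchreierBasis.

(** * Stallings automata *)

Lemma sval_inj (T : Type) (P : T -> Prop) : injective (@sval T P).
Proof. by move=> [x px] [y py] /= e; subst y; congr exist; exact: Prop_irrelevance. Qed.

Section Paths.
Variables (C : eqType) (Q : automaton C).
Implicit Types (p q : vertex Q) (s : seq (edge Q)).

Lemma is_path_cat p s1 s2 q :
  is_path p (s1 ++ s2) q <-> exists2 r, is_path p s1 r & is_path r s2 q.
Proof.
elim: s1 p => [|e s1 IH] p /=; first by split=> [h|[_ -> //]]; exists p.
split=> [[ep /IH [r h1 h2]]|[r [ep h1] h2]]; first by exists r.
by split=> //; apply/IH; exists r.
Qed.

Lemma is_path_inj p s q r : is_path p s q -> is_path p s r -> q = r.
Proof. by elim: s p => [|e s IH] p /= => [<- //|[_ h] [_ /(IH _ h)]]. Qed.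

(** In a deterministic automaton, consecutive edges with mutually inverse labels are mutually
    inverse edges. *)
Lemma reduced_path_label p s q : deterministic Q -> is_path p s q -> reduced_path s ->
  reduced_word (map (@label _ Q) s).
Proof.
move=> dQ; elim: s p => [//|e [//|f s] IH] p /= [_ [ef hp]] hs.
have := IH (tgt e); rewrite /= => ->.
- rewrite andbT; apply/eqP => lf; apply: (hs [::] e f s erefl).
  by apply: dQ; rewrite ?label_inv //; left; rewrite src_inv.
- by [].
- by move=> s1 e' f' s2 es; apply: (hs (e :: s1) e' f' s2); rewrite es.
Qed.

Lemma label_reduced_path s : reduced_word (map (@label _ Q) s) -> reduced_path s.
Proof.
move=> hs s1 e f s2 es fe; move: hs; rewrite es map_cat => /cat_sorted2 [_] /=.
by rewrite fe label_inv eqxx.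
Qed.

(** In a trim automaton each vertex is the basepoint or the end of an edge, so surjectivity on edges
    suffices. *)
Lemma trim_hom_onto (R : automaton C) (theta : hom R Q) :
  trim Q -> range (emap theta) = setT -> hom_onto theta.
Proof.
move=> [tv _] et; split=> //; apply/seteqP; split=> // p _.
have [s1 [s2 [_]]] := tv p; case/lastP: s1 => [/= <-|s1 f].
  by exists (base R); [|exact: vmap_base].
rewrite -cats1 => /is_path_cat[r _ [_ /= <-]].
have [e _ <-] : range (emap theta) f by rewrite et.
by exists (tgt e); [|rewrite tgt_emap].
Qed.

End Paths.

(** * Gamma_X(H) as the core of the Schreier graph *)

Section CosetAutomaton.
Variables (G : groupType) (X : set G).

Definition core (H v : set G) := exists w1 w2 : seq (letter X),
  [/\ reduced_word (w1 ++ w2), H (wval (w1 ++ w2)) & v = rtrans H (wval w1)].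

Section OneSubgroup.
Variables (H : set G) (hH : is_subgroup H).

Lemma core_base : core H H.
Proof. by exists [::], [::]; rewrite wval_nil rtrans1; split=> //; exact: subgroup1. Qed.

Lemma crossed_core v (x : letter X) : crossed H H v x -> core H v.
Proof. by move=> [w1 [w2 [rw Hw ->]]]; exists w1, (x :: w2). Qed.

Let V := {v | core H v}.
Let E := {e : set G * letter X | crossed H H e.1 e.2}.

Let esrc (e : E) : V := exist _ (sval e).1 (crossed_core (svalP e)).
Let einv (e : E) : E := exist _ (rtrans (sval e).1 (lval (sval e).2), flip (sval e).2)
  (esym_crossed hH hH (fun _ => id) (svalP e)).

Let einvK e : einv (einv e) = e.
Proof.
by apply: sval_inj; case: e => [[v x] h] /=; rewrite lval_flip rtransK flipK.
Qed.

(** The target is defined as the source of the inverse edge, which makes [src_inv] definitional and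
    reduces [tgt_inv] to involutivity. *)
Definition coset_automaton : automaton X :=
  @Automaton X V E esrc (fun e => esrc (einv e)) (fun e => (sval e).2) einv
    (exist _ H core_base) einvK (fun=> erefl) (fun e => congr1 esrc (einvK e)) (fun=> erefl).

Local Notation Q := coset_automaton.

Lemma coset_automaton_path_end (p q : vertex Q) s : is_path p s q ->
  sval q = rtrans (sval p) (wval (map (@label _ Q) s)).
Proof.
elim: s p => [|e s IH] p /=; first by move=> <-; rewrite wval_nil rtrans1.
by move=> [<- /IH ->]; rewrite wval_cons rtransM.
Qed.

Lemma coset_automaton_path (p : vertex Q) w : epath (crossed H H) (sval p) w ->
  exists s q, is_path p s q /\ map (@label _ Q) s = w.
Proof.
elim: w p => [|x w IH] p /=; first by exists [::], p.
move=> [hx hw]; pose e : edge Q := exist _ (sval p, x) hx.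
have [s [q [hs sw]]] := IH (tgt e) hw.
exists (e :: s), q; split=> /=; last by rewrite sw.
by split=> //; exact: sval_inj.
Qed.

Lemma coset_automaton_closed_path w : reduced_word w -> H (wval w) ->
  exists s, reduced_closed_path (Q := Q) s /\ map (@label _ Q) s = w.
Proof.
move=> rw Hw.
have [s [q [hs sw]]] := coset_automaton_path (p := base Q) (epath_crossed H rw Hw).
exists s; split=> //; split; last by apply: label_reduced_path; rewrite sw.
suff e : q = base Q by rewrite e in hs.
by apply: sval_inj; rewrite (coset_automaton_path_end hs) sw (rtrans_id _ hH).2.
Qed.

Lemma coset_automaton_deterministic : deterministic Q.
Proof.
move=> [[v x] hv] [[u y] hu] /= xy h; apply: sval_inj => /=; subst y; congr (_, _).
case: h => /(congr1 sval) /= e //.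
by rewrite -(rtransK v (lval x)) e rtransK.
Qed.

Lemma coset_automaton_trim : trim Q.
Proof.
split=> [[v hv]|[[v x] he]].
- have [w1 [w2 [rw Hw vE]]] := hv.
  have [s [[hs rs] sw]] := coset_automaton_closed_path rw Hw.
  have s1w : map (@label _ Q) (take (size w1) s) = w1 by rewrite map_take sw take_size_cat.
  exists (take (size w1) s), (drop (size w1) s); rewrite cat_take_drop; split=> //.
  move: hs; rewrite -{1}(cat_take_drop (size w1) s) => /is_path_cat[r hr _].
  suff <- : r = exist _ v hv by [].
  by apply: sval_inj; rewrite (coset_automaton_path_end hr) s1w.
- have [w1 [w2 [rw Hw /= vE]]] := he.
  have [s [[hs rs] sw]] := coset_automaton_closed_path rw Hw.
  have s1w : map (@label _ Q) (take (size w1) s) = w1 by rewrite map_take sw take_size_cat.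
  have := congr1 (drop (size w1)) sw; rewrite drop_size_cat // -map_drop.
  case sE : (drop (size w1) s) => [//|f s2] /= [fx _].
  exists (take (size w1) s), s2.
  suff -> : exist _ (v, x) he = f by rewrite -sE cat_take_drop.
  move: hs; rewrite -(cat_take_drop (size w1) s) sE => /is_path_cat[r hr [fr _]].
  have /(congr1 sval) /= fv := fr.
  apply: sval_inj; rewrite /= [RHS]surjective_pairing -fx fv /=.
  by rewrite (coset_automaton_path_end hr) s1w vE.
Qed.

Lemma coset_automaton_connected : connected Q.
Proof.
move=> p q; have [tv _] := coset_automaton_trim.
have [s1 [s2 [[h _] hp]]] := tv p; have [s3 [_ [_ hq]]] := tv q.
exists (s2 ++ s3); apply/is_path_cat; exists (base Q) => //.
by move/is_path_cat: h => [r /(is_path_inj hp) <-].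
Qed.

Lemma coset_automaton_stallings : basis [set: G] X -> is_stallings_of H Q.
Proof.
move=> hX; split.
  split; [exact: coset_automaton_connected | exact: coset_automaton_deterministic
         | exact: coset_automaton_trim].
apply/seteqP; split=> [g [s [[hs _] ->]]|g Hg].
  apply/(rtrans_id _ hH).
  by rewrite -[H in rtrans H]/(sval (base Q)) -(coset_automaton_path_end hs).
have [w [rw e]] := basis_word hX (I : setT g); rewrite -e in Hg *.
by have [s [hs <-]] := coset_automaton_closed_path rw Hg; exists s.
Qed.

End OneSubgroup.

Section Theta.
Variables (H K : set G) (hH : is_subgroup H) (hK : is_subgroup K) (HK : H `<=` K).

Lemma lcos_core v : core H v -> core K (lcos K v).
Proof.
move=> [w1 [w2 [rw Hw ->]]]; exists w1, w2; split=> //; first exact: HK.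
by rewrite lcos_rtrans lcos_subgroup.
Qed.

Lemma lcos_crossed v (x : letter X) : crossed H H v x -> crossed K K (lcos K v) x.
Proof.
move=> [w1 [w2 [rw Hw ->]]]; exists w1, w2; split=> //; first exact: HK.
by rewrite lcos_rtrans lcos_subgroup.
Qed.

Lemma crossed_lcos v (x : letter X) : crossed H K v x ->
  exists2 u, crossed H H u x & lcos K u = v.
Proof.
move=> [w1 [w2 [rw Hw ->]]]; exists (rtrans H (wval w1)); first by exists w1, w2.
by rewrite lcos_rtrans lcos_subgroup.
Qed.

Let tv (p : vertex (coset_automaton hH)) : vertex (coset_automaton hK) :=
  exist _ (lcos K (sval p)) (lcos_core (svalP p)).
Let te (e : edge (coset_automaton hH)) : edge (coset_automaton hK) :=
  exist _ (lcos K (sval e).1, (sval e).2) (lcos_crossed (svalP e)).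

Lemma coset_hom_exists : exists theta : hom (coset_automaton hH) (coset_automaton hK),
  emap theta = te.
Proof.
have hs e : src (te e) = tv (src e) by exact: sval_inj.
have ht e : tgt (te e) = tv (tgt e) by apply: sval_inj => /=; rewrite lcos_rtrans.
have hb : tv (base (coset_automaton hH)) = base (coset_automaton hK).
  by apply: sval_inj => /=; exact: lcos_subgroup.
by exists (Hom hs ht (fun=> erefl) hb).
Qed.

Lemma theta_onto_crossed : basis [set: G] X ->
  (forall v (x : letter X), crossed K K v x -> crossed H K v x) -> theta_onto X H K.
Proof.
move=> hX h; have [theta thetaE] := coset_hom_exists.
exists (coset_automaton hH), (coset_automaton hK), theta.
split; [exact: coset_automaton_stallings | exact: coset_automaton_stallings |].
apply: trim_hom_onto; first exact: coset_automaton_trim.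
apply/seteqP; split=> // -[[v x] hf] _.
have [u hu uv] := crossed_lcos (h _ _ hf).
exists (exist _ (u, x) hu); rewrite // thetaE.
by apply: sval_inj; rewrite /= uv.
Qed.

End Theta.

Lemma algebraic_theta_onto H K : basis [set: G] X -> algebraic H K -> theta_onto X H K.
Proof.
move=> hX aHK; have [[hH hK HK] _] := aHK.
apply: (theta_onto_crossed hH hK HK hX) => v x.
exact: algebraic_crossed.
Qed.

(* Gamma(H) only has edges labelled in a basis of a free factor containing H, hence so
   does its image Gamma(M). *)
Lemma theta_onto_sub_generated Y H M : X `<=` Y -> basis [set: G] Y ->
  theta_onto Y H M -> H `<=` generated X -> M `<=` generated X.
Proof.
move=> XY hY [QH [QM [theta [[[_ dH [_ tH]] lH] [_ lM] [_ oe]]]]] HX m.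
rewrite -lM => -[s [_ ->]].
have lX (e : edge QM) : X (val (label e).1).
  have [e' _ <-] : range (emap theta) e by rewrite oe.
  rewrite label_emap; have [s1 [s2 hs]] := tH e'.
  have rw := reduced_path_label dH hs.1 hs.2.
  apply: (reduced_word_letters XY hY rw).
    by apply: HX; rewrite -lH; exists (s1 ++ e' :: s2).
  by rewrite map_cat mem_cat in_cons eqxx orbT.
have hg := generated_subgroup X.
elim: s => [|e s IH]; first by rewrite wval_nil; exact: subgroup1.
rewrite /= wval_cons; apply: (subgroupM hg) IH.
rewrite /lval; case: (_.2); last apply: (subgroupV hg); apply: sub_generated; exact: lX.
Qed.

End CosetAutomaton.

(** * Transport along an injective morphism *)

Section Image.
Variables (G G' : groupType) (phi : {multiplicative G -> G'}).

Lemma image_subgroup (H : set G) : is_subgroup H -> is_subgroup (phi @` H).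
Proof.
move=> hH; split; first by exists 1; [exact: subgroup1 | rewrite multiplicative1].
split=> [_ _ [g Hg <-] [h Hh <-]|_ [g Hg <-]].
  by exists (g * h); [exact: subgroupM | rewrite gmulfM].
by exists g^-1; [exact: subgroupV | rewrite multiplicativeV].
Qed.

(** Being algebraic is intrinsic to the pair: a free factor of the image of K pulls back, with its
    bases, to a free factor of K. *)
Lemma algebraic_image (H K : set G) : injective phi -> algebraic H K ->
  algebraic (phi @` H) (phi @` K).
Proof.
move=> phiI [[hH hK HK] aHK].
split; first by split; [exact: image_subgroup | exact: image_subgroup | exact: image_subset].
have preK : phi @^-1` (phi @` K) = K.
  by apply/seteqP; split=> [g [k Kk /phiI <-]|g Kg] //; exists g.
move=> L [X [Y [XY hX hY]]] HL.
have Kphi : phi @` K `<=` range phi by apply: image_subset.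
have LK : L `<=` phi @` K.
  case: hX => <- _; apply: generated_sub; first exact: image_subgroup.
  exact: subset_trans XY (basis_sub hY).
have LE : phi @^-1` L = K.
  apply: aHK.
    exists (phi @^-1` X), (phi @^-1` Y); split; first by apply: preimage_subset.
      by apply: basis_preimage => //; exact: subset_trans Kphi.
    by rewrite -{1}preK; exact: basis_preimage.
  by move=> h Hh; apply: HL; exists h.
apply/seteqP; split=> // _ [k Kk <-].
by rewrite -LE in Kk.
Qed.

End Image.

(** * Comparison of the closures *)

Section Closures.
Variable F : groupType.
Implicit Types H L M : set F.

Lemma onto_sub_free_factor H L M : onto H M -> free_factor [set: F] L -> H `<=` L ->
  M `<=` L.
Proof.
move=> [_ oM] [X [Y [XY [LE _] hY]]] HL; rewrite -LE in HL *.
exact: theta_onto_sub_generated XY hY (oM _ hY) HL.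
Qed.

Lemma algebraic_onto H M : algebraic H M -> onto H M.
Proof. by move=> aM; split; [case: aM | move=> X hX; exact: algebraic_theta_onto]. Qed.

Lemma algebraic_fully_onto (A H M : set F) : algebraic H M -> fully_onto A H M.
Proof.
move=> aM; split; first by case: aM.
move=> G' B phi _ phiI _ B' hB'.
by apply: algebraic_theta_onto => //; exact: algebraic_image.
Qed.

Lemma fully_onto_onto (A H M : set F) : basis [set: F] A -> fully_onto A H M -> onto H M.
Proof.
move=> hA [eM h]; split=> // X hX.
(* F itself, with the basis A and the identity, is one of the admissible overgroups. *)
have := h F A idfun hA (fun _ _ => id).
by rewrite !image_id; apply.
Qed.

(** Of two candidates, each is an onto extension of H and the other a free factor containing H, so
    each contains the other. The description [Cl] then does not fall back on its default. *)
Lemma Cl_unique H L : is_algebraic_closure [set: F] H L -> Cl [set: F] H = L.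
Proof.
have le M N : is_algebraic_closure [set: F] H M -> is_algebraic_closure [set: F] H N ->
    M `<=` N.
  move=> [_ _ _ /algebraic_onto oM _] [_ HN _ _ fN].
  exact: onto_sub_free_factor oM fN HN.
have uniq_cl M N : is_algebraic_closure [set: F] H M -> is_algebraic_closure [set: F] H N ->
    M = N by move=> hM hN; apply/seteqP; split; exact: le.
move=> hL; apply: xget_unique => [|M [hM _]]; last exact: uniq_cl.
by split=> // M; exact: uniq_cl.
Qed.

End Closures.

Theorem corollary4p4 (F : groupType) (A : set F)
    (finA : finite_set A) (freeA : basis [set: F] A)
    (H : set F) (fgH : finitely_generated H) :
  Cl [set: F] H = fOCl A [set: F] H /\
  fOCl A [set: F] H = OCl [set: F] H /\
  free_factor [set: F] (Cl [set: F] H).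
Proof.
have hH : is_subgroup H by have [X [_ ->]] := fgH; exact: generated_subgroup.
have [a aA] := (finite_seqP A).1 finA.
have ga : generated [set` a] = [set: F] by rewrite -aA; case: freeA.
have [L hL] := algebraic_closure_exists freeA ga hH (@subsetT _ H).
rewrite (Cl_unique hL); have [sL HL _ aL fL] := hL.
have LfO : L `<=` fOCl A [set: F] H.
  by move=> g Lg; apply: sub_generated; exists L => //; split=> //;
    exact: algebraic_fully_onto.
have fOO : fOCl A [set: F] H `<=` OCl [set: F] H.
  apply: generatedS => g [M [hM _] Mg]; exists M => //.
  by split=> //; exact: fully_onto_onto freeA hM.
have OL : OCl [set: F] H `<=` L.
  apply: generated_sub sL _ => g [M [oM _] Mg].
  exact: onto_sub_free_factor oM fL HL _ Mg.
split; last split=> //; apply/seteqP; split=> //.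
- exact: subset_trans fOO OL.
- exact: subset_trans OL LfO.
Qed.
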